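(* Let $t:\mathbb{N}\to\mathbb{N}$ be any monotone increasing function with $t(n)\le n/2$. Then \[BQC(COUNT^{t(n)}_n)\ge\Omega\!\left(\frac{t(n)}{\log t(n)}+\log n\right).\]
   Context: For $x,y\in\{0,1\}^n$, $COUNT^t_n(x,y)=1$ iff $\sum_{i=1}^n(x_i\wedge y_i)=t$. $\log$ is base 2. Quantum communication model (Yao, no prior entanglement): Alice receives $x$, Bob $y$; each holds private qubits initialized to the input and $|0\rangle$; in each round one player applies a unitary to his qubits and sends one qubit; at the end a qubit is measured giving the output; cost is the number of qubits exchanged. $BQC(f)$ is the minimum cost of a protocol computing $f$ with error probability at most $1/3$ on every input. *)

(* Defs.v *)
From HB Require Import structures.
From mathcomp Require Import all_boot all_order all_algebra.
From mathcomp Require Import complex.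
From mathcomp Require Import reals exp.
Unset Printing Implicit Defensive.
Import Order.TTheory GRing.Theory Num.Theory.
Local Open Scope ring_scope.
Local Open Scope complex_scope.

Definition COUNT (t n : nat) (x y : {ffun 'I_n -> bool}) : bool :=
  (\sum_(i < n) (x i && y i))%N == t.

Section Quantum.
Variable R : rcfType.
Local Notation C := (R[i]).

(* an operator on the Hilbert space with orthonormal basis indexed by T *)
Definition op (T : finType) := T -> T -> C.
Definition unitary {T : finType} (U : op T) : Prop :=
  forall i j : T, \sum_(k : T) U i k * (U j k)^* = (i == j)%:R.

(* a private register of a player: n input qubits + w workspace qubits *)
Definition reg (n w : nat) := ({ffun 'I_n -> bool} * {ffun 'I_w -> bool})%type.

(* one round: a player applies a unitary to his private qubits together with
   the communication qubit, which is then sent to the other player *)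
Inductive step (TA TB : finType) :=
  | AliceStep of op (TA * bool)%type
  | BobStep of op (bool * TB)%type.

Definition step_unitary {TA TB : finType} (s : step TA TB) : Prop :=
  match s with AliceStep U => unitary U | BobStep U => unitary U end.

Fixpoint all_unitary {TA TB : finType} (s : seq (step TA TB)) : Prop :=
  match s with [::] => True | st :: s' => step_unitary st /\ all_unitary s' end.

Record protocol (n : nat) := Protocol {
  wa : nat; wb : nat;
  steps : seq (step (reg n wa) (reg n wb)) }.
Arguments wa {n}. Arguments wb {n}. Arguments steps {n}.

(* global state: Alice's qubits, the communication qubit, Bob's qubits *)
Definition state (TA TB : finType) := (TA * bool * TB)%type -> C.

Definition apply_step {TA TB : finType} (s : step TA TB) (v : state TA TB)
  : state TA TB :=
  match s with
  | AliceStep U => fun abc => let: (a, c, b) := abc in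
      \sum_(p : TA * bool) U (a, c) p * v (p.1, p.2, b)
  | BobStep U => fun abc => let: (a, c, b) := abc in
      \sum_(p : bool * TB) U (c, b) p * v (a, p.1, p.2)
  end.

Definition init_state n wa wb (x y : {ffun 'I_n -> bool})
  : state (reg n wa) (reg n wb) :=
  fun abc => let: (a, c, b) := abc in
    ((a == (x, [ffun=> false])) && (c == false)
     && (b == (y, [ffun=> false])))%:R.
Arguments init_state {n} wa wb x y _.

Definition final_state {n} (P : protocol n) (x y : {ffun 'I_n -> bool}) :=
  foldl (fun v s => apply_step s v) (init_state (wa P) (wb P) x y) (steps P).

(* probability that measuring the (last transmitted) communication qubit
   in the computational basis yields the bit o *)
Definition prob_out {n} (P : protocol n) (x y : {ffun 'I_n -> bool}) (o : bool)
  : C :=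
  \sum_(a : reg n (wa P)) \sum_(b : reg n (wb P)) `|final_state P x y (a, o, b)| ^+ 2.

Definition cost {n} (P : protocol n) : nat := size (steps P).

Definition computes {n} (f : {ffun 'I_n -> bool} -> {ffun 'I_n -> bool} -> bool)
  (P : protocol n) : Prop :=
  all_unitary (steps P) /\
  forall x y, prob_out P x y (~~ f x y) <= 1 / 3%:R.

End Quantum.
Arguments wa {R n}. Arguments wb {R n}. Arguments steps {R n}.
Arguments AliceStep {R TA TB}. Arguments BobStep {R TA TB}.
Arguments init_state {R n} wa wb x y _.

Definition log2 {R : realType} (x : R) : R := ln x / ln 2.

Definition count_bound (R : realType) (t n : nat) : R :=
  (if (2 <= t)%N then t%:R / log2 (t%:R : R) else 0) + log2 (n%:R : R).

(* Main.v *)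
Require Import Defs.
From HB Require Import structures.
From mathcomp Require Import all_boot all_order all_algebra.
From mathcomp Require Import complex ring lra zify.
From mathcomp Require Import reals exp.
Import Order.TTheory GRing.Theory Num.Theory.
Local Open Scope ring_scope.

(** After [q] rounds the global state is a sum of [2^q] product vectors of norm
    at most [1], so the matrix of probabilities of a given outcome is a sum of
    [2 * 4^q] real rank-one matrices with entries in [[-1, 1]].  If [W] has
    orthogonal [+-1] rows, Cauchy-Schwarz bounds the correlation of [W] with a
    sum of [N] such terms by [N * #|Y| * sqrt #|X|].

    For the [log n] term, fixing [t - 1] common ones and letting Alice hold a
    unit vector turns COUNT into the index function, whose sign matrix has
    orthogonal rows and which therefore needs [N >= sqrt n] up to constants.

    For the [t / log t] term, some [j] is the intersection size of a fraction
    at least [1 / (t + 1)] of the pairs in [{0,1}^t]; padding with [t - j]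
    common ones makes COUNT test for exactly this [j].  Its correlation with
    [(-1)^<x, y>] is then at least [1 / (t + 1)], while short sums only reach
    [N * 2^(-t/2)].  Applying the majority polynomial of degree [O(log t)]
    entrywise to the probabilities makes the error smaller than
    [1 / (2 (t + 1))] and raises [N] to the power [O(log t)]. *)

(** * Square norms and unitaries *)

Section SquareNorm.
Variable C : numClosedFieldType.

Definition sqnorm {T : finType} (v : T -> C) : C := \sum_k `|v k| ^+ 2.

Lemma sqnorm_pair (S T : finType) (v : S * T -> C) :
  sqnorm v = \sum_i sqnorm (fun j => v (i, j)).
Proof. by rewrite /sqnorm pair_bigA; apply: eq_bigr => -[]. Qed.

Lemma sqnorm_delta (T : finType) (k : T) :
  sqnorm (fun l => (l == k)%:R) = 1.
Proof.
rewrite /sqnorm (bigD1 k) //= eqxx normr1 expr1n big1 ?addr0 // => l /negPf->.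
by rewrite normr0 expr0n.
Qed.

(** Summing [2 |v k| |w k| <= |v k|^2 + |w k|^2] over [k] replaces Cauchy-Schwarz, both norms being
    at most 1. *)
Lemma norm_inner_le1 (T : finType) (v w : T -> C) :
  sqnorm v <= 1 -> sqnorm w <= 1 -> `|\sum_k v k * (w k)^*| <= 1.
Proof.
move=> hv hw; rewrite -(ler_pM2l (ltr0n _ 2)) mulr1.
apply: (le_trans (y := sqnorm v + sqnorm w)); last by rewrite -[2]/(1 + 1) lerD.
rewrite /sqnorm -big_split /=.
apply: (le_trans (ler_wpM2l _ (ler_norm_sum _ _ _))); first exact: ler0n.
rewrite mulr_sumr; apply: ler_sum => k _.
rewrite normrM norm_conjC -subr_ge0.
suff -> : `|v k| ^+ 2 + `|w k| ^+ 2 - 2 * (`|v k| * `|w k|)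
  = (`|v k| - `|w k|) ^+ 2 by rewrite -realEsqr rpredB ?normr_real.
by ring.
Qed.

(* [Defs.unitary] only asserts orthonormality of the rows. *)
Lemma unitary_columns (T : finType) (U : T -> T -> C) :
  (forall i j, \sum_k U i k * (U j k)^* = (i == j)%:R) ->
  forall k l, \sum_i U i k * (U i l)^* = (k == l)%:R.
Proof.
move=> hU k l.
pose A : 'M[C]_#|T| := \matrix_(i, j) U (enum_val i) (enum_val j).
pose B : 'M[C]_#|T| := \matrix_(i, j) (U (enum_val j) (enum_val i))^*.
have AB : A *m B = 1%:M.
  apply/matrixP => i j; rewrite !mxE -(inj_eq enum_val_inj) -hU.
  rewrite [RHS](reindex _ (onW_bij _ (enum_val_bij T))).
  by apply: eq_bigr => m _; rewrite !mxE.
have /matrixP/(_ (enum_rank l) (enum_rank k)) := mulmx1C AB.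
rewrite !mxE (inj_eq enum_rank_inj) eq_sym => <-.
rewrite (reindex _ (onW_bij _ (enum_val_bij T))).
by apply: eq_bigr => m _; rewrite !mxE !enum_rankK mulrC.
Qed.

Lemma unitary_sqnorm (T : finType) (U : T -> T -> C) (v : T -> C) :
  (forall i j, \sum_k U i k * (U j k)^* = (i == j)%:R) ->
  sqnorm (fun i => \sum_k U i k * v k) = sqnorm v.
Proof.
move=> hU; have hc := unitary_columns T U hU.
rewrite /sqnorm.
transitivity (\sum_i \sum_k \sum_l (U i k * (U i l)^*) * (v k * (v l)^*)).
  apply: eq_bigr => i _; rewrite normCK rmorph_sum mulr_suml.
  apply: eq_bigr => k _; rewrite mulr_sumr; apply: eq_bigr => l _.
  by rewrite rmorphM; ring.
rewrite exchange_big; apply: eq_bigr => k _.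
rewrite exchange_big (bigD1 k) //= -mulr_suml hc eqxx mul1r -normCK.
rewrite big1 ?addr0 // => l /negPf nlk.
by rewrite -mulr_suml hc eq_sym nlk mul0r.
Qed.

End SquareNorm.

(** * Sums of bounded rank-one matrices *)

(** Unlike plain rank, a count of terms with bounded factors controls correlations, since each term
    can be estimated separately. [K] is complex for amplitudes and real for probabilities. *)
Definition rank1_sum {K : numDomainType} {X Y : Type} (N : nat)
  (M : X -> Y -> K) : Prop :=
  exists (I : finType) (u : I -> X -> K) (v : I -> Y -> K),
    [/\ (#|I| <= N)%N, forall i x, `|u i x| <= 1, forall i y, `|v i y| <= 1
      & forall x y, M x y = \sum_i u i x * v i y].

Lemma rank1_sum_comp (K : numDomainType) (X Y X' Y' : Type) N
    (M : X -> Y -> K) (f : X' -> X) (g : Y' -> Y) :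
  rank1_sum N M -> rank1_sum N (fun x y => M (f x) (g y)).
Proof.
move=> [I [u [v [hN hu hv hM]]]].
by exists I, (fun i x => u i (f x)), (fun i y => v i (g y)); split.
Qed.

Lemma rank1_sum0 (K : numDomainType) (X Y : Type) N :
  rank1_sum N (fun (_ : X) (_ : Y) => 0 : K).
Proof.
exists void, (fun _ _ => 0), (fun _ _ => 0).
by split=> *; rewrite ?card_void ?normr0 ?ler01 // big_pred0 // => -[].
Qed.

Lemma rank1_sum1 (K : numDomainType) (X Y : Type) :
  rank1_sum 1 (fun (_ : X) (_ : Y) => 1 : K).
Proof.
exists unit, (fun _ _ => 1), (fun _ _ => 1).
by split=> *; rewrite ?card_unit ?normr1 // big_const card_unit /= mulr1 addr0.
Qed.

Lemma rank1_sumD (K : numDomainType) (X Y : Type) N N' (M M' : X -> Y -> K) :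
  rank1_sum N M -> rank1_sum N' M' ->
  rank1_sum (N + N') (fun x y => M x y + M' x y).
Proof.
move=> [I [u [v [hN hu hv hM]]]] [J [u' [v' [hN' hu' hv' hM']]]].
exists (I + J)%type, (fun i => match i with inl i => u i | inr j => u' j end),
  (fun i => match i with inl i => v i | inr j => v' j end).
split=> [|[]|[]|x y] //; first by rewrite card_sum leq_add.
by rewrite big_sumType hM hM'.
Qed.

Lemma rank1_sumN (K : numDomainType) (X Y : Type) N (M : X -> Y -> K) :
  rank1_sum N M -> rank1_sum N (fun x y => - M x y).
Proof.
move=> [I [u [v [hN hu hv hM]]]].
exists I, (fun i x => - u i x), v; split=> [|i x||x y] //; first by rewrite normrN.
by rewrite hM -sumrN; apply: eq_bigr => i _; rewrite mulNr.
Qed.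

Lemma rank1_sum_leq (K : numDomainType) (X Y : Type) N N' (M : X -> Y -> K) :
  (N <= N')%N -> rank1_sum N M -> rank1_sum N' M.
Proof.
move=> le [I [u [v [hN hu hv hM]]]].
by exists I, u, v; split=> //; apply: leq_trans le.
Qed.

Lemma rank1_sumM (K : numDomainType) (X Y : Type) N N' (M M' : X -> Y -> K) :
  rank1_sum N M -> rank1_sum N' M' ->
  rank1_sum (N * N') (fun x y => M x y * M' x y).
Proof.
move=> [I [u [v [hN hu hv hM]]]] [J [u' [v' [hN' hu' hv' hM']]]].
exists (I * J)%type, (fun i x => u i.1 x * u' i.2 x),
  (fun i y => v i.1 y * v' i.2 y).
split=> [|i x|i y|x y]; first by rewrite card_prod leq_mul.
- by rewrite normrM mulr_ile1.
- by rewrite normrM mulr_ile1.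
rewrite hM hM' mulr_suml -(pair_bigA _ (fun i j =>
  u i x * u' j x * (v i y * v' j y))).
by apply: eq_bigr => i _; rewrite mulr_sumr; apply: eq_bigr => j _; rewrite mulrACA.
Qed.

Lemma rank1_sumX (K : numDomainType) (X Y : Type) N k (M : X -> Y -> K) :
  rank1_sum N M -> rank1_sum (N ^ k) (fun x y => M x y ^+ k).
Proof.
move=> hM; elim: k => [|k IH]; first exact: rank1_sum1.
rewrite expnS; have [I [u [v [h1 h2 h3 h4]]]] := rank1_sumM _ _ _ _ _ _ _ hM IH.
by exists I, u, v; split=> // x y; rewrite exprS h4.
Qed.

Lemma rank1_sumMn (K : numDomainType) (X Y : Type) N k (M : X -> Y -> K) :
  rank1_sum N M -> rank1_sum (k * N) (fun x y => M x y *+ k).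
Proof.
move=> hM; elim: k => [|k IH]; first exact: rank1_sum0.
rewrite mulSn; have [I [u [v [h1 h2 h3 h4]]]] := rank1_sumD _ _ _ _ _ _ _ hM IH.
by exists I, u, v; split=> // x y; rewrite mulrS h4.
Qed.

Lemma rank1_sum_sum (K : numDomainType) (X Y : Type) (I : Type) (r : seq I)
    (P : pred I) (N : I -> nat) (M : I -> X -> Y -> K) :
  (forall i, P i -> rank1_sum (N i) (M i)) ->
  rank1_sum (\sum_(i <- r | P i) N i) (fun x y => \sum_(i <- r | P i) M i x y).
Proof.
move=> hM; elim: r => [|i r IH].
  have [J [u [v [h1 h2 h3 h4]]]] := rank1_sum0 K X Y 0.
  by exists J, u, v; split=> [||| x y]; rewrite ?big_nil.
case Pi: (P i); last first.
  by have [J [u [v [h1 h2 h3 h4]]]] := IH; exists J, u, v;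
    split=> [||| x y]; rewrite ?big_cons ?Pi.
have [J [u [v [h1 h2 h3 h4]]]] := rank1_sumD _ _ _ _ _ _ _ (hM i Pi) IH.
by exists J, u, v; split=> [||| x y]; rewrite ?big_cons ?Pi ?h4.
Qed.

(** Since [Re (u v) = Re u Re v - Im u Im v], each complex term yields two real ones. *)
Lemma rank1_sum_Re (R : rcfType) (X Y : Type) N (M : X -> Y -> R[i]) :
  rank1_sum N M -> rank1_sum (2 * N) (fun x y => complex.Re (M x y)).
Proof.
move=> [I [u [v [hN hu hv hM]]]].
have Re1 (z : R[i]) : `|z| <= 1 -> `|complex.Re z| <= 1.
  by move=> h; rewrite -lecR; apply: le_trans (normc_ge_Re z) h.
have Im1 (z : R[i]) : `|z| <= 1 -> `|complex.Im z| <= 1.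
  move=> h; rewrite -normrN -ReiNIm; apply: Re1.
  by rewrite normrM [X in _ * X]normc_def /= expr0n expr1n add0r sqrtr1 mulr1.
exists (bool * I)%type,
  (fun i x => if i.1 then complex.Re (u i.2 x) else - complex.Im (u i.2 x)),
  (fun i y => if i.1 then complex.Re (v i.2 y) else complex.Im (v i.2 y)).
split=> [|[[] i] x|[[] i] y|x y] /=; rewrite ?normrN; auto.
  by rewrite card_prod card_bool leq_mul2l.
rewrite -(pair_bigA _ (fun (b : bool) i =>
  (if b then complex.Re (u i x) else - complex.Im (u i x)) *
  (if b then complex.Re (v i y) else complex.Im (v i y)))) big_bool /=.
rewrite hM (raddf_sum (@complex.Re R : Rcomplex R -> R)) -big_split /=.
by apply: eq_bigr => i _; case: (u i x) (v i y) => a b [c d] /=; rewrite mulNr.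
Qed.

(** * Protocol states *)

Section ProtocolStates.
Variables (R : rcfType) (TA TB : finType).
Local Notation C := (R[i]).

(** A step is [U] tensored with the identity: it preserves the norm of every slice in which the idle
    player's register is fixed. *)
Lemma apply_step_sqnorm (s : step R TA TB) (v : state R TA TB) :
  step_unitary R s ->
  sqnorm _ (apply_step R s v) = sqnorm _ v.
Proof.
case: s => U /= hU.
- rewrite !(sqnorm_pair C (TA * bool)%type TB) /sqnorm.
  rewrite exchange_big [RHS]exchange_big; apply: eq_bigr => b _ /=.
  transitivity (sqnorm C (fun i => \sum_p U i p * v (p.1, p.2, b))).
    by apply: eq_bigr => -[a c] _.
  by rewrite (unitary_sqnorm C) //; apply: eq_bigr => -[a c] _.
- have split3 (w : state R TA TB) : sqnorm C w =
      \sum_a sqnorm C (fun cb : bool * TB => w (a, cb.1, cb.2)).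
    rewrite sqnorm_pair.
    transitivity (\sum_p sqnorm C (fun b => w (p.1, p.2, b))).
      by apply: eq_bigr => -[].
    rewrite -(pair_bigA _ (fun a c => sqnorm C (fun b => w (a, c, b)))).
    by apply: eq_bigr => a _; rewrite sqnorm_pair.
  rewrite !split3; apply: eq_bigr => a _.
  rewrite -(unitary_sqnorm C _ U (fun cb => v (a, cb.1, cb.2))) //.
  by apply: eq_bigr => -[].
Qed.

Lemma foldl_sqnorm (l : seq (step R TA TB)) (v : state R TA TB) :
  all_unitary R l ->
  sqnorm _ (foldl (fun v s => apply_step R s v) v l) = sqnorm _ v.
Proof. by elim: l v => //= s l IH v [hs hl]; rewrite IH // apply_step_sqnorm. Qed.

(* The index counts the histories of the communication qubit: a step of one
   player splits each product term according to the qubit's previous value. *)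
Definition factored {X Y : Type} (N : nat) (v : X -> Y -> state R TA TB) :=
  exists (I : finType) (A : I -> X -> bool -> TA -> C)
    (B : I -> Y -> bool -> TB -> C),
  [/\ #|I| = N, forall i x c, sqnorm C (A i x c) <= 1,
      forall i y c, sqnorm C (B i y c) <= 1 &
      forall x y a c b, v x y (a, c, b) = \sum_i A i x c a * B i y c b].

Lemma apply_step_factored (X Y : Type) N (v : X -> Y -> state R TA TB) s :
  step_unitary R s -> factored N v ->
  factored (2 * N) (fun x y => apply_step R s (v x y)).
Proof.
have term_le (T : finType) (f : T -> C) k : `|f k| ^+ 2 <= sqnorm C f.
  rewrite /sqnorm (bigD1 k) //= lerDl sumr_ge0 // => l _.
  by rewrite exprn_ge0.
case: s => U /= hU [I [A [B [hN hA hB hv]]]].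
- exists (bool * I)%type,
    (fun j x c a => \sum_p U (a, c) p *
       (if p.2 == j.1 then A j.2 x j.1 p.1 else 0)),
    (fun j y c b => B j.2 y j.1 b).
  split=> [|[c' i] x c|[c' i] y c|x y a c b] //=.
  + by rewrite card_prod card_bool hN.
  + apply: le_trans (hA i x c').
    (* The new factor at outgoing value [c] is a slice of [U w], where [w] is [A i x c'] placed at
       qubit value [c']. Slicing cannot increase the norm and [U] preserves it. *)
    pose w (p : TA * bool) := if p.2 == c' then A i x c' p.1 else 0.
    apply: (le_trans (y := sqnorm C (fun q : TA * bool => \sum_p U q p * w p))).
      rewrite [leRHS]sqnorm_pair; apply: ler_sum => a _.
      exact: (term_le _ (fun c => \sum_p U (a, c) p * w p)).
    rewrite (unitary_sqnorm C) // sqnorm_pair; apply: ler_sum => a _.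
    rewrite /sqnorm (bigD1 c') //= big1 ?addr0 /w /= ?eqxx // => c0 /negPf->.
    by rewrite normr0 expr0n.
  + rewrite -(pair_bigA _ (fun c' i => (\sum_p U (a, c) p *
       (if p.2 == c' then A i x c' p.1 else 0)) * B i y c' b)).
    transitivity (\sum_p \sum_i U (a, c) p * (A i x p.2 p.1 * B i y p.2 b)).
      by apply: eq_bigr => p _; rewrite hv mulr_sumr.
    under [RHS]eq_bigr => c' _.
      under eq_bigr => i _ do rewrite mulr_suml.
      rewrite exchange_big; over.
    rewrite [RHS]exchange_big /=; apply: eq_bigr => p _.
    rewrite exchange_big /=; apply: eq_bigr => i _.
    rewrite (bigD1 p.2) //= eqxx big1 ?addr0 ?mulrA // => c' /negPf nc.
    by rewrite eq_sym nc mulr0 mul0r.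
- exists (bool * I)%type, (fun j x c a => A j.2 x j.1 a),
    (fun j y c b => \sum_p U (c, b) p *
       (if p.1 == j.1 then B j.2 y j.1 p.2 else 0)).
  split=> [|[c' i] x c|[c' i] y c|x y a c b] //=.
  + by rewrite card_prod card_bool hN.
  + apply: le_trans (hB i y c').
    pose w (p : bool * TB) := if p.1 == c' then B i y c' p.2 else 0.
    apply: (le_trans (y := sqnorm C (fun q : bool * TB => \sum_p U q p * w p))).
      rewrite [leRHS]sqnorm_pair [leRHS]exchange_big; apply: ler_sum => b _.
      exact: (term_le _ (fun c => \sum_p U (c, b) p * w p)).
    rewrite (unitary_sqnorm C) // sqnorm_pair.
    rewrite (bigD1 c') //= big1 ?addr0 /w /sqnorm /= ?eqxx // => c0 /negPf->.
    by rewrite big1 // => b _; rewrite normr0 expr0n.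
  + rewrite -(pair_bigA _ (fun c' i => A i x c' a * (\sum_p U (c, b) p *
       (if p.1 == c' then B i y c' p.2 else 0)))).
    transitivity (\sum_p \sum_i U (c, b) p * (A i x p.1 a * B i y p.1 p.2)).
      by apply: eq_bigr => p _; rewrite hv mulr_sumr.
    under [RHS]eq_bigr => c' _.
      under eq_bigr => i _ do rewrite mulr_sumr.
      rewrite exchange_big; over.
    rewrite [RHS]exchange_big /=; apply: eq_bigr => p _.
    rewrite exchange_big /=; apply: eq_bigr => i _.
    rewrite (bigD1 p.1) //= eqxx big1 ?addr0; first by rewrite mulrCA.
    by move=> c' /negPf nc; rewrite eq_sym nc !mulr0.
Qed.

Lemma foldl_factored (X Y : Type) N (l : seq (step R TA TB))
    (v : X -> Y -> state R TA TB) :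
  all_unitary R l -> factored N v ->
  factored (2 ^ size l * N)
    (fun x y => foldl (fun v s => apply_step R s v) (v x y) l).
Proof.
elim: l N v => [|s l IH] N v /=; first by rewrite mul1n.
move=> [hs hl] hv; rewrite expnSr -mulnA.
exact: IH hl (apply_step_factored _ _ _ _ _ hs hv).
Qed.

(* Expanding |sum_i A_i B_i|^2 over pairs of indices turns each measurement
   probability into a sum of products of Gram entries. *)
Lemma factored_measure (X Y : Type) N (v : X -> Y -> state R TA TB) c :
  factored N v ->
  rank1_sum (N * N) (fun x y => \sum_a \sum_b `|v x y (a, c, b)| ^+ 2).
Proof.
move=> [I [A [B [hN hA hB hv]]]].
exists (I * I)%type,
  (fun ij x => \sum_a A ij.1 x c a * (A ij.2 x c a)^*),
  (fun ij y => \sum_b B ij.1 y c b * (B ij.2 y c b)^*).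
split=> [|i x|i y|x y].
- by rewrite card_prod hN.
- exact: norm_inner_le1.
- exact: norm_inner_le1.
rewrite -(pair_bigA _ (fun i j => (\sum_a A i x c a * (A j x c a)^*) *
  (\sum_b B i y c b * (B j y c b)^*))) /=.
transitivity (\sum_a \sum_b \sum_i \sum_j
    (A i x c a * (A j x c a)^*) * (B i y c b * (B j y c b)^*)).
  apply: eq_bigr => a _; apply: eq_bigr => b _.
  rewrite normCK hv rmorph_sum mulr_suml; apply: eq_bigr => i _.
  by rewrite mulr_sumr; apply: eq_bigr => j _; rewrite rmorphM; ring.
under [LHS]eq_bigr => a _ do rewrite exchange_big.
rewrite exchange_big; apply: eq_bigr => i _ /=.
under [LHS]eq_bigr => a _ do rewrite exchange_big.
rewrite exchange_big; apply: eq_bigr => j _ /=.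
rewrite mulr_suml; apply: eq_bigr => a _.
by rewrite mulr_sumr.
Qed.

End ProtocolStates.

Lemma init_state_factored (R : rcfType) n wa wb :
  factored R (reg n wa) (reg n wb) 1 (fun x y => init_state (R := R) wa wb x y).
Proof.
exists unit,
  (fun _ x c a => ((a == (x, [ffun=> false])) && ~~ c)%:R),
  (fun _ y c b => (b == (y, [ffun=> false]))%:R).
have le1 (T : finType) (k : T) (c : bool) :
    sqnorm R[i] (fun l => ((l == k) && ~~ c)%:R) <= 1.
  case: c => /=; first by rewrite /sqnorm big1 // => l _; rewrite andbF normr0 expr0n.
  by under [X in X <= _]eq_bigr => l _ do rewrite andbT; rewrite [leLHS]sqnorm_delta.
split=> [|_ x c|_ y c|x y a c b]; first exact: card_unit.
- exact: le1.
- by rewrite sqnorm_delta.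
- rewrite big_const card_unit /= addr0 -natrM mulnb.
  by case: c; rewrite ?andbF ?andbT.
Qed.

Lemma init_state_sqnorm (R : rcfType) n wa wb (x y : {ffun 'I_n -> bool}) :
  sqnorm R[i] (init_state (R := R) wa wb x y) = 1.
Proof.
rewrite -(sqnorm_delta R[i] (reg n wa * bool * reg n wb)%type
  ((x, [ffun=> false]), false, (y, [ffun=> false]))).
by apply: eq_bigr => -[[a c] b] _ /=; rewrite !xpair_eqE.
Qed.

Lemma prob_out_sum (R : rcfType) n (P : protocol R n) x y :
  all_unitary R (steps P) ->
  prob_out R P x y false + prob_out R P x y true = 1.
Proof.
move=> hP; rewrite -(init_state_sqnorm R n (wa P) (wb P) x y).
rewrite -(foldl_sqnorm _ _ _ (steps P)) // sqnorm_pair.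
transitivity (\sum_p sqnorm R[i] (fun b => final_state R P x y (p.1, p.2, b)));
  last by apply: eq_bigr => -[].
rewrite -(pair_bigA _ (fun a c => sqnorm R[i] (fun b => final_state R P x y (a, c, b)))).
rewrite exchange_big big_bool addrC.
by congr (_ + _); apply: eq_bigr.
Qed.

(** This is the only information about the quantum model used below. The [4 ^ cost] counts pairs of
    qubit histories; the factor 2 comes from passing to real parts. *)
Lemma protocol_matrices (R : rcfType) n f (P : protocol R n) :
  computes R f P ->
  exists p : bool -> {ffun 'I_n -> bool} -> {ffun 'I_n -> bool} -> R,
  [/\ forall o, rank1_sum (2 * 4 ^ cost R P) (p o),
      forall o x y, 0 <= p o x y,
      forall x y, p false x y + p true x y = 1 &
      forall x y, p (~~ f x y) x y <= 1 / 3].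
Proof.
move=> [hU herr].
exists (fun o x y => complex.Re (prob_out R P x y o)).
split=> [o|o x y|x y|x y].
- apply: rank1_sum_Re.
  have := foldl_factored _ _ _ _ _ _ (steps P) _ hU
    (init_state_factored R n (wa P) (wb P)).
  by move=> /factored_measure -/(_ o); rewrite muln1 -expnMn.
- have : 0 <= prob_out R P x y o.
    by apply: sumr_ge0 => a _; apply: sumr_ge0 => b _; rewrite exprn_ge0.
  by rewrite lecE => /andP[].
- by have /(congr1 (complex.Re (R := R))) := prob_out_sum _ _ P x y hU; case: prob_out; case: prob_out.
- have := herr x y; rewrite lecE => /andP[_].
  have -> : 1 / 3%:R = (1 / 3%:R : R)%:C%C :> R[i].
    by rewrite rmorphM rmorph1 fmorphV rmorph_nat.
  by [].
Qed.

(** * Discrepancy and amplification *)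

Section Discrepancy.
(** [c] stands for the square root of [#|X|], which a [realFieldType] need not contain. *)
Variables (R : realFieldType) (X Y : finType) (W : X -> Y -> R) (c : R).
Hypotheses (c_gt0 : 0 < c) (c_sq : c ^+ 2 = #|X|%:R).
Hypothesis W_orth :
  forall x x', \sum_y W x y * W x' y = if x == x' then #|Y|%:R else 0.

(* [|v g| <= |g| <= (c + g^2 / c) / 2] replaces Cauchy-Schwarz. *)
Lemma rank1_discrepancy (u : X -> R) (v : Y -> R) :
  (forall x, `|u x| <= 1) -> (forall y, `|v y| <= 1) ->
  `|\sum_x \sum_y (u x * v y) * W x y| <= #|Y|%:R * c.
Proof.
move=> hu hv; pose g y := \sum_x u x * W x y.
have -> : \sum_x \sum_y (u x * v y) * W x y = \sum_y v y * g y.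
  rewrite exchange_big; apply: eq_bigr => y _; rewrite mulr_sumr.
  by apply: eq_bigr => x _; rewrite mulrCA mulrA.
(* Orthogonality of the rows kills the cross terms, leaving [#|Y|] times the sum of [u x ^+ 2]. *)
have g2 : \sum_y g y ^+ 2 <= #|Y|%:R * c ^+ 2.
  have -> : \sum_y g y ^+ 2 = \sum_x #|Y|%:R * u x ^+ 2.
    transitivity (\sum_y \sum_x \sum_x' (u x * u x') * (W x y * W x' y)).
      apply: eq_bigr => y _; rewrite expr2 mulr_suml; apply: eq_bigr => x _.
      by rewrite mulr_sumr; apply: eq_bigr => x' _; rewrite mulrACA.
    rewrite exchange_big; apply: eq_bigr => x _.
    rewrite exchange_big (bigD1 x) //= -mulr_sumr W_orth eqxx big1 ?addr0.
      by rewrite mulrC expr2.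
    by move=> x' /negPf nx; rewrite -mulr_sumr W_orth eq_sym nx mulr0.
  rewrite -mulr_sumr ler_wpM2l // c_sq.
  rewrite -sum1_card natr_sum; apply: ler_sum => x _.
  by rewrite -real_normK ?num_real // expr_le1.
have gc y : `|v y * g y| <= (c + g y ^+ 2 / c) / 2.
  apply: (le_trans (y := `|g y|)).
    by rewrite normrM ler_piMl.
  rewrite -(ler_pM2r c_gt0).
  have -> : (c + g y ^+ 2 / c) / 2 * c = (c ^+ 2 + `|g y| ^+ 2) / 2.
    by rewrite real_normK ?num_real //; field; rewrite gt_eqF.
  have := sqr_ge0 (c - `|g y|); nra.
apply: (le_trans (ler_norm_sum _ _ _)).
apply: (le_trans (ler_sum _ (fun y _ => gc y))).
rewrite -mulr_suml big_split /= -mulr_suml sumr_const -mulr_natl.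
have : (\sum_y g y ^+ 2) / c <= #|Y|%:R * c by rewrite ler_pdivrMr // -mulrA -expr2.
by lra.
Qed.

Lemma rank1_sum_discrepancy N (M : X -> Y -> R) :
  rank1_sum N M -> `|\sum_x \sum_y M x y * W x y| <= N%:R * (#|Y|%:R * c).
Proof.
move=> [I [u [v [hN hu hv hM]]]].
have -> : \sum_x \sum_y M x y * W x y =
    \sum_i \sum_x \sum_y (u i x * v i y) * W x y.
  rewrite [RHS]exchange_big; apply: eq_bigr => x _.
  rewrite [RHS]exchange_big; apply: eq_bigr => y _.
  by rewrite hM mulr_suml.
apply: (le_trans (ler_norm_sum _ _ _)).
apply: (le_trans (y := \sum_(i : I) #|Y|%:R * c)).
  by apply: ler_sum => i _; apply: rank1_discrepancy.
rewrite sumr_const -[X in X <= _]mulr_natl ler_wpM2r ?ler_nat //.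
by rewrite mulr_ge0 ?ler0n // ltW.
Qed.

End Discrepancy.

(** * Amplification by the majority polynomial *)

Section Majority.
Variable R : realFieldType.

(** The probability of at least [k] successes in [2 k] independent trials, with success probability
    [a] and failure probability [b]. Keeping it homogeneous in both variables lets it be applied to
    a pair of matrices. *)
Definition majority (k : nat) (a b : R) : R :=
  \sum_(j < (2 * k).+1 | (k <= j)%N) (b ^+ (2 * k - j) * a ^+ j) *+ 'C(2 * k, j).

(** The binomial coefficients sum to [4^k] and [a b <= 2/9], which gives [(4 * 2/9)^k]. Both tails
    of the majority are instances. *)
Lemma binomial_tail_le k (a b : R) (Q : pred 'I_(2 * k).+1) :
  0 <= a -> 0 <= b -> a + b = 1 -> (a <= 1 / 3) || (b <= 1 / 3) ->
  (forall j, Q j -> b ^+ (2 * k - j) * a ^+ j <= (a * b) ^+ k) ->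
  \sum_(j | Q j) (b ^+ (2 * k - j) * a ^+ j) *+ 'C(2 * k, j) <= (8 / 9) ^+ k.
Proof.
move=> a0 b0 ab h13 hQ.
apply: (le_trans (y := \sum_(j < (2 * k).+1) (a * b) ^+ k *+ 'C(2 * k, j))).
  rewrite big_mkcond; apply: ler_sum => j _; case: ifP => Qj.
    by rewrite ler_wMn2r // hQ.
  by rewrite mulrn_wge0 // exprn_ge0 // mulr_ge0.
rewrite sumrMnr.
have -> : (\sum_(i < (2 * k).+1) 'C(2 * k, i) = 4 ^ k)%N.
  have -> : (4 ^ k = (1 + 1) ^ (2 * k))%N by rewrite expnM.
  rewrite expnDn.
  by apply: eq_bigr => i _; rewrite !exp1n !muln1.
rewrite -[leLHS]mulr_natl natrX -exprMn lerXn2r ?nnegrE //.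
- by rewrite !mulr_ge0.
- by lra.
- by case/orP: h13 => h; nra.
Qed.

Lemma majority_small k (a b : R) :
  0 <= a -> 0 <= b -> a + b = 1 -> a <= 1 / 3 -> majority k a b <= (8 / 9) ^+ k.
Proof.
move=> a0 b0 ab a13; apply: binomial_tail_le => //; first by rewrite a13.
move=> j kj; have jk := ltn_ord j; rewrite exprMn mulrC.
(* As [a <= b], the [j - k] surplus factors [a] may be replaced by [b], giving [a^k b^k]. *)
have -> : a ^+ j = a ^+ k * a ^+ (j - k) by rewrite -exprD subnKC.
have -> : b ^+ k = b ^+ (j - k) * b ^+ (2 * k - j).
  by rewrite -exprD; congr (_ ^+ _); lia.
rewrite -mulrA ler_wpM2l ?exprn_ge0 // ler_wpM2r ?exprn_ge0 //.
by rewrite lerXn2r ?nnegrE //; lra.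
Qed.

(** Expanding [1 = (b + a)^(2k)], the missing part is the tail [j < k], bounded as before with [a]
    and [b] exchanged. *)
Lemma majority_large k (a b : R) :
  0 <= a -> 0 <= b -> a + b = 1 -> b <= 1 / 3 ->
  1 - (8 / 9) ^+ k <= majority k a b.
Proof.
move=> a0 b0 ab b13.
have := exprDn b a (2 * k); rewrite addrC ab expr1n => h1.
rewrite lerBlDr {1}h1 (bigID (fun j : 'I__ => (k <= j)%N)) /= lerD2l.
apply: binomial_tail_le => //; first by rewrite b13 orbT.
move=> j; rewrite -ltnNge => jk; rewrite exprMn.
have -> : b ^+ (2 * k - j) = b ^+ (k - j) * b ^+ k.
  by rewrite -exprD; congr (_ ^+ _); lia.
have -> : a ^+ k = a ^+ j * a ^+ (k - j) by rewrite -exprD subnKC // ltnW.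
rewrite mulrC !mulrA ler_wpM2r ?exprn_ge0 // ler_wpM2l ?exprn_ge0 //.
by rewrite lerXn2r ?nnegrE //; lra.
Qed.

Lemma majority_le1 k (a b : R) :
  0 <= a -> 0 <= b -> a + b = 1 -> majority k a b <= 1.
Proof.
move=> a0 b0 ab.
have := exprDn b a (2 * k); rewrite addrC ab expr1n => ->.
rewrite [leRHS](bigID (fun j : 'I__ => (k <= j)%N)) /= lerDl sumr_ge0 // => j _.
by rewrite mulrn_wge0 // mulr_ge0 // exprn_ge0.
Qed.

Lemma majority_ge0 k (a b : R) : 0 <= a -> 0 <= b -> 0 <= majority k a b.
Proof.
by move=> a0 b0; apply: sumr_ge0 => j _; rewrite mulrn_wge0 // mulr_ge0 // exprn_ge0.
Qed.

(** The term counts add up, by the binomial theorem, to at most [(N + N)^(2k)]. *)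
Lemma rank1_sum_majority (X Y : Type) N k (A B : X -> Y -> R) :
  rank1_sum N A -> rank1_sum N B ->
  rank1_sum ((2 * N) ^ (2 * k)) (fun x y => majority k (A x y) (B x y)).
Proof.
move=> hA hB.
apply: (rank1_sum_leq _ _ _ (\sum_(j < (2 * k).+1 | (k <= j)%N)
    'C(2 * k, j) * (N ^ (2 * k - j) * N ^ j))).
  rewrite [(2 * N)%N]mul2n -addnn expnDn big_mkcond /=; apply: leq_sum => j _.
  by case: ifP.
apply: rank1_sum_sum => j _; apply: rank1_sumMn.
by apply: rank1_sumM; apply: rank1_sumX.
Qed.

End Majority.

Lemma amplified_matrix (R : rcfType) n f (P : protocol R n) k :
  computes R f P ->
  exists M : {ffun 'I_n -> bool} -> {ffun 'I_n -> bool} -> R,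
    rank1_sum (4 ^ ((cost R P).+1 * (2 * k))) M /\
    forall x y, `|M x y - (f x y)%:R| <= (8 / 9) ^+ k.
Proof.
move=> /protocol_matrices [p [hp p0 p1 perr]].
exists (fun x y => majority R k (p true x y) (p false x y)); split.
  (* The base is [2 * (2 * 4^q) = 4^(q+1)] with [q] the cost. *)
  rewrite expnM expnS -[4%N]/(2 * 2)%N -mulnA.
  exact: rank1_sum_majority (hp true) (hp false).
move=> x y; have ab : p true x y + p false x y = 1 by rewrite addrC.
have := perr x y; case: (f x y) => /= h.
  rewrite distrC ger0_norm ?subr_ge0 ?majority_le1 //.
  by rewrite lerBlDr addrC -lerBlDr majority_large.
by rewrite subr0 ger0_norm ?majority_ge0 // majority_small.
Qed.

(** * Lower bounds for COUNT *)

Definition meet_size {m : nat} (x y : {ffun 'I_m -> bool}) : nat :=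
  \sum_(i < m) (x i && y i).

Lemma meet_size_le m (x y : {ffun 'I_m -> bool}) : (meet_size x y <= m)%N.
Proof.
rewrite -[leqRHS]card_ord -sum1_card; apply: leq_sum => i _.
by case: (_ && _).
Qed.

Lemma card_cube m : #|{ffun 'I_m -> bool}| = (2 ^ m)%N.
Proof. by rewrite card_ffun card_bool card_ord. Qed.

(** This is the Sylvester-Hadamard matrix. The sum over [y] factors over coordinates, and one where
    [x] and [x'] differ contributes [1 - 1 = 0]. *)
Lemma meet_sign_orth (R : realFieldType) m (x x' : {ffun 'I_m -> bool}) :
  \sum_y (-1) ^+ meet_size x y * (-1) ^+ meet_size x' y =
  if x == x' then #|{ffun 'I_m -> bool}|%:R else 0 :> R.
Proof.
pose F i (b : bool) : R := (-1) ^+ (x i && b) * (-1) ^+ (x' i && b).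
transitivity (\sum_(y : {ffun 'I_m -> bool}) \prod_i F i (y i)).
  by apply: eq_bigr => y _; rewrite big_split /= !prodrXr.
rewrite -bigA_distr_bigA /=.
have FE i : \sum_b F i b = if x i == x' i then 2 else 0.
  by rewrite big_bool /F !andbT !andbF; case: (x i); case: (x' i);
    rewrite /= ?expr0 ?expr1; ring.
under eq_bigr => i _ do rewrite FE.
case: eqP => [->|/eqP neq].
  under eq_bigr => i _ do rewrite eqxx.
  by rewrite prodr_const card_cube card_ord natrX.
have [i ni] : exists i, x i != x' i.
  apply/existsP; rewrite -negb_forall; apply: contra neq => /forallP h.
  by apply/eqP/ffunP => i; apply/eqP.
by rewrite (bigD1 i) //= (negPf ni) mul0r.
Qed.

(* Coordinates [m, ..., m + p - 1] are filled with ones, the later ones with zeros. *)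
Definition pad (m p n : nat) (x : {ffun 'I_m -> bool}) : {ffun 'I_n -> bool} :=
  [ffun l : 'I_n => oapp x (l < m + p)%N (insub (l : nat))].

Lemma meet_size_pad m p n (x y : {ffun 'I_m -> bool}) : (m + p <= n)%N ->
  meet_size (pad m p n x) (pad m p n y) = (meet_size x y + p)%N.
Proof.
move=> mpn.
pose F (l : nat) : nat := oapp x (l < m + p)%N (insub l) && oapp y (l < m + p)%N (insub l).
have -> : meet_size (pad m p n x) (pad m p n y) = (\sum_(0 <= l < n) F l)%N.
  by rewrite big_mkord; apply: eq_bigr => l _; rewrite !ffunE.
rewrite (big_cat_nat (n := m)) //=; last exact: leq_trans (leq_addr _ _) mpn.
rewrite (big_cat_nat (n := (m + p)%N) (m := m)) ?leq_addr //=.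
congr (_ + _)%N.
  by rewrite big_mkord; apply: eq_bigr => i _; rewrite /F valK.
have out l : (m <= l)%N -> F l = (l < m + p)%N.
  by move=> ml; rewrite /F insubF /= ?andbb // ltnNge ml.
rewrite [X in (_ + X)%N]big_nat_cond [X in (_ + X)%N]big1 ?addn0; last first.
  move=> l /andP[/andP[h _] _].
  by rewrite out ?(leq_trans (leq_addr _ _) h) // ltnNge h.
rewrite big_nat_cond (eq_bigr (fun=> 1%N)); last first.
  by move=> l /andP[/andP[h1 h2] _]; rewrite out // h2.
by rewrite -big_nat_cond sum_nat_const_nat muln1 addKn.
Qed.

(** Fixed common ones turn a given threshold into a test for any smaller intersection size. *)
Lemma COUNT_pad m p n j (x y : {ffun 'I_m -> bool}) : (m + p <= n)%N ->
  COUNT (j + p) n (pad m p n x) (pad m p n y) = (meet_size x y == j).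
Proof.
by move=> h; rewrite /COUNT -/(meet_size _ _) meet_size_pad // eqn_add2r.
Qed.

(** Pigeonhole: [4^m] pairs are distributed over [m + 1] sizes. *)
Lemma popular_meet_size m : exists2 j, (j <= m)%N &
  (4 ^ m <= m.+1 * #|[set p : {ffun 'I_m -> bool} * {ffun 'I_m -> bool}
                       | meet_size p.1 p.2 == j]|)%N.
Proof.
pose T := ({ffun 'I_m -> bool} * {ffun 'I_m -> bool})%type.
pose N (j : 'I_m.+1) := #|[set p : T | meet_size p.1 p.2 == j]|.
have sumN : (\sum_j N j = 4 ^ m)%N.
  have <- : #|{: T}| = (4 ^ m)%N by rewrite card_prod card_cube -expnMn.
  rewrite -sum1_card (partition_big (fun p : T =>
    Ordinal (meet_size_le m p.1 p.2 : (_ < m.+1)%N)) xpredT) //=.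
  by apply: eq_bigr => j _; rewrite /N -sum1_card; apply: eq_bigl => p; rewrite inE.
have [j _ jmax] := @arg_maxnP _ ord0 xpredT N isT.
exists j; first by rewrite -ltnS.
rewrite -sumN -/(N j) -[X in (_ <= X * _)%N]card_ord -sum_nat_const.
by apply: leq_sum => i _; apply: jmax.
Qed.

(** Two estimates of the correlation [S] give [2^t <= 2 (t + 1) N 2^(t/2)]; the conclusion is its
    square divided by [2^t]. *)
Lemma count_cost_linear (R : rcfType) n t (P : protocol R n) k :
  (2 * t <= n)%N -> computes R (COUNT t n) P ->
  (8 / 9) ^+ k <= ((2 * t.+1)%:R)^-1 :> R ->
  (2 ^ t <= (2 * t.+1 * 4 ^ ((cost R P).+1 * (2 * k))) ^ 2)%N.
Proof.
move=> tn hP heps.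
have [j jt hj] := popular_meet_size t.
have [M [hM Merr]] := amplified_matrix R n _ P k hP.
set N := (4 ^ _)%N in hM *.
pose Y := {ffun 'I_t -> bool}.
(* The [t] free and [t - j] padded coordinates fit because [2 t <= n]. *)
pose e := pad t (t - j) n.
pose W (x y : Y) : R := (-1) ^+ meet_size x y.
pose c : R := Num.sqrt (2 ^ t)%:R.
have c_gt0 : 0 < c by rewrite sqrtr_gt0 ltr0n expn_gt0.
have c_sq : c ^+ 2 = #|Y|%:R by rewrite sqr_sqrtr ?ler0n // card_cube.
have := rank1_sum_discrepancy R Y Y W c c_gt0 c_sq (meet_sign_orth R t) N _
  (rank1_sum_comp _ _ _ _ _ _ _ e e hM).
set S := \sum_x _ => hS.
pose S0 : R := \sum_(x : Y) \sum_(y : Y) (meet_size x y == j)%:R * W x y.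
have S0E : `|S0| = #|[set p : Y * Y | meet_size p.1 p.2 == j]|%:R.
  (* The sign is constant on pairs of intersection size [j], so nothing cancels. *)
  have -> : S0 = (-1) ^+ j * #|[set p : Y * Y | meet_size p.1 p.2 == j]|%:R.
    rewrite /S0 pair_bigA -sum1_card natr_sum mulr_sumr [RHS]big_mkcond /=.
    apply: eq_bigr => p _; rewrite inE /W.
    by case: eqP => [->|_]; rewrite ?mul1r ?mulr1 ?mul0r.
  by rewrite normrM normrX normrN1 expr1n mul1r ger0_norm.
have SS0 : `|S - S0| <= (4 ^ t)%:R * (2 * t.+1)%:R^-1.
  rewrite /S /S0 -sumrB.
  under eq_bigr => x _ do rewrite -sumrB.
  rewrite pair_bigA /=.
  apply: (le_trans (ler_norm_sum _ _ _)).
  apply: (le_trans (y := \sum_(p : Y * Y) (2 * t.+1)%:R^-1)).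
    apply: ler_sum => p _; rewrite -mulrBl normrM /W normrX normrN1 expr1n mulr1.
    apply: le_trans heps.
    by rewrite -(COUNT_pad t (t - j) n) ?subnKC //; lia.
  by rewrite sumr_const card_prod card_cube -expnMn mulr_natl.
have t1 : 0 < (2 * t.+1)%:R :> R by rewrite ltr0n.
(* The exact correlation is at least [4^t / (t + 1)], and the approximation error costs at most half
   of that. *)
have low : (4 ^ t)%:R <= (2 * t.+1)%:R * `|S|.
  have tri : `|S0| <= `|S| + `|S - S0|.
    by have := ler_normB S (S - S0); rewrite opprB addrC subrK.
  have hj' : (4 ^ t)%:R <= t.+1%:R * `|S0| by rewrite S0E -natrM ler_nat.
  have h2 : (2 * t.+1)%:R * `|S - S0| <= (4 ^ t)%:R.
    by rewrite mulrC -ler_pdivlMr.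
  have := ler_wpM2l (ltW t1) tri; rewrite mulrDr natrM => h3.
  by move: h2 h3; rewrite !natrM; nra.
have up : (2 ^ t)%:R <= (2 * t.+1)%:R * N%:R * c.
  have pos : 0 < (2 ^ t)%:R :> R by rewrite ltr0n expn_gt0.
  rewrite -(ler_pM2r pos) -[leLHS]natrM -expnMn; apply: (le_trans low).
  by apply: (le_trans (ler_wpM2l (ltW t1) hS)); rewrite card_cube; lra.
have pos : 0 < (2 ^ t)%:R :> R by rewrite ltr0n expn_gt0.
rewrite -(ler_nat R) [leRHS]natrX [in leRHS]natrM -(ler_pM2r pos).
have -> : (2 ^ t)%:R * (2 ^ t)%:R = (2 ^ t)%:R ^+ 2 :> R by rewrite expr2.
rewrite -[X in _ <= _ * X%:R](card_cube t) -c_sq -exprMn.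
by rewrite lerXn2r ?nnegrE ?ler0n // mulr_ge0 ?mulr_ge0 ?ler0n // ltW.
Qed.

(** For [count_cost_log] this constant bias suffices, without amplification. *)
Lemma bias_ge (R : realFieldType) (a b : R) (f : bool) :
  a + b = 1 -> (if f then a else b) <= 1 / 3 -> 1 / 3 <= (b - a) * (-1) ^+ (~~ f).
Proof. by case: f => /= ? ?; rewrite ?expr0 ?expr1; lra. Qed.

Lemma count_cost_log (R : rcfType) n t (P : protocol R n) :
  (2 * t <= n)%N -> computes R (COUNT t n) P ->
  (n <= 288 * 16 ^ cost R P)%N.
Proof.
move=> tn hP; have [p [hp p0 p1 perr]] := protocol_matrices _ _ _ _ hP.
(* The coordinates left free by [t - 1] padded ones; for [t = 0] there is no padding. *)
pose m := (n - t.-1)%N.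
have [m0|m_gt0] := posnP m; first by move: m0; rewrite /m; lia.
pose e := pad m t.-1 n.
pose d (i : 'I_m) := [ffun l : 'I_m => l == i].
pose Y := {ffun 'I_m -> bool}.
have meet_d i (y : Y) : meet_size (d i) y = y i.
  rewrite /meet_size (bigD1 i) //= ffunE eqxx big1 ?addn0 // => l /negPf nl.
  by rewrite ffunE nl.
(* The instance computes [y i] when [t > 0], and its negation when [t = 0]. *)
have fE i (y : Y) : COUNT t n (e (d i)) (e y) = (y i == (0 < t)%N).
  have tE : t = ((0 < t) + t.-1)%N by case: (t).
  rewrite {1}tE COUNT_pad ?meet_d; first by case: (y i); case: (0 < t)%N.
  by rewrite /m; lia.
pose W (i : 'I_m) (y : Y) : R := (-1) ^+ (~~ (y i == (0 < t)%N)).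
(* Up to a common sign these are the Hadamard rows indexed by the unit vectors [d i]. *)
have W_orth i i' : \sum_y W i y * W i' y = if i == i' then #|{: Y}|%:R else 0.
  have -> : (i == i') = (d i == d i').
    apply/eqP/eqP => [->//|/ffunP/(_ i)]; rewrite !ffunE eqxx.
    by move/esym/eqP.
  rewrite -(meet_sign_orth R); apply: eq_bigr => y _; rewrite !meet_d /W.
  by case: (y i); case: (y i'); case: (0 < t)%N; rewrite /= ?expr1 ?expr0; ring.
pose c : R := Num.sqrt m%:R.
have c_gt0 : 0 < c by rewrite sqrtr_gt0 ltr0n.
have c_sq : c ^+ 2 = #|'I_m|%:R by rewrite sqr_sqrtr ?ler0n // card_ord.
pose M x y := p true x y + - p false x y.
have hM := rank1_sumD _ _ _ _ _ _ _ (hp true) (rank1_sumN _ _ _ _ _ (hp false)).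
have := rank1_sum_discrepancy R _ Y W c c_gt0 c_sq W_orth _ _
  (rank1_sum_comp _ _ _ _ _ _ _ (e \o d) e hM).
set S := \sum_x _ => hS.
have low : m%:R * (2 ^ m)%:R / 3 <= S.
  have -> : m%:R * (2 ^ m)%:R / 3 = \sum_(i < m) \sum_(y : Y) (1 / 3) :> R.
    under eq_bigr => i _ do rewrite sumr_const card_cube.
    by rewrite sumr_const card_ord -[RHS]mulr_natr -[X in _ = X * _]mulr_natr; field.
  apply: ler_sum => i _; apply: ler_sum => y _.
  by rewrite /= /W -fE; apply: bias_ge; [exact: p1|case: COUNT (perr (e (d i)) (e y))].
have := le_trans low (le_trans (ler_norm _) hS).
rewrite card_cube addnn -muln2.
have pos : 0 < (2 ^ m)%:R :> R by rewrite ltr0n expn_gt0.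
set N := (_ * 2)%N => h1.
have h2 : m%:R <= 3 * N%:R * c.
  rewrite -(ler_pM2r pos).
  have -> : 3 * N%:R * c * (2 ^ m)%:R = N%:R * ((2 ^ m)%:R * c) * 3 by ring.
  by rewrite -ler_pdivrMr.
have h3 : m%:R <= (3 * N%:R) ^+ 2 :> R.
  have m0 : 0 < m%:R :> R by rewrite ltr0n.
  rewrite -(ler_pM2r m0) -expr2 -[X in _ <= _ * X%:R](card_ord m) -c_sq -exprMn.
  by rewrite lerXn2r ?nnegrE ?ler0n // mulr_ge0 ?mulr_ge0 ?ler0n // ltW.
have h4 : (m <= (3 * N) ^ 2)%N by rewrite -(ler_nat R) natrX natrM.
(* With [N = 4 * 4^q], the constant is [288 = 2 * (3 * 4)^2]. *)
have : (n <= 2 * m)%N by rewrite /m; lia.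
move=> /leq_trans; apply.
apply: (leq_trans (n := (2 * (3 * N) ^ 2)%N)); first by rewrite leq_mul2l.
have -> : (16 ^ cost R P = 4 ^ cost R P * 4 ^ cost R P)%N by rewrite -expnMn.
by rewrite /N; nia.
Qed.

Lemma count_cost_up_log (R : rcfType) n t (P : protocol R n) :
  (2 * t <= n)%N -> computes R (COUNT t n) P ->
  (t <= 50 * up_log 2 (2 * t.+1) * (cost R P).+1)%N.
Proof.
move=> tn hP; set L := up_log _ _.
have hL : (2 * t.+1 <= 2 ^ L)%N by exact: up_logP.
(* The degree parameter is [6 L] because [(8/9)^6 <= 1/2]. *)
have eps : (8 / 9) ^+ (6 * L) <= ((2 * t.+1)%:R)^-1 :> R.
  apply: (le_trans (y := (2^-1) ^+ L)).
    by rewrite exprM lerXn2r ?nnegrE ?exprn_ge0 //; lra.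
  by rewrite exprVn lef_pV2 ?posrE ?exprn_gt0 // -natrX ler_nat.
have := count_cost_linear R n t P (6 * L) tn hP eps.
set q := cost R P => h.
have : (2 ^ t <= 2 ^ (2 * (L + 24 * L * q.+1)))%N.
  apply: (leq_trans h); rewrite [(2 * (L + _))%N]mulnC [leqRHS]expnM leq_exp2r //.
  rewrite expnD leq_mul // -[4%N]/(2 ^ 2)%N -expnM leq_exp2l //; lia.
by rewrite leq_exp2l // => /leq_trans; apply; nia.
Qed.

(** * Logarithm estimates and final constants *)

Lemma log2_le (R : realType) (m a : nat) :
  (0 < m)%N -> (m <= 2 ^ a)%N -> log2 m%:R <= a%:R :> R.
Proof.
move=> m0 ma; have l2 : 0 < ln (2 : R) by rewrite ln_gt0 // ltr1n.
rewrite /log2 ler_pdivrMr // mulr_natl -lnXn // ler_ln ?posrE ?exprn_gt0 ?ltr0n //.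
by rewrite -natrX ler_nat.
Qed.

Lemma up_log_le_log2 (R : realType) (t : nat) : (2 <= t)%N ->
  1 <= log2 t%:R :> R /\ (up_log 2 (2 * t.+1))%:R <= 4 * log2 t%:R :> R.
Proof.
move=> t2; have t0 := ltnW t2; have l2 : 0 < ln (2 : R) by rewrite ln_gt0 // ltr1n.
have ge1 : 1 <= log2 t%:R :> R.
  rewrite /log2 ler_pdivlMr // mul1r ler_ln ?posrE ?ltr0n //.
  by rewrite ler_nat.
split=> //; set L := up_log _ _.
have L0 : (0 < L)%N by rewrite up_log_gt0; lia.
(* Here [2 (t + 1) <= t^3] for [t >= 2], whence [L <= 1 + 3 log t <= 4 log t]. *)
have hLt : (2 ^ L.-1 <= t ^ 3)%N.
  apply: leq_trans (ltnW (up_log_gtn _ _)) _ => //; first by lia.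
  by rewrite !expnS expn0; nia.
have : ln ((2 : R) ^+ L.-1) <= ln (t%:R ^+ 3).
  by rewrite ler_ln ?posrE ?exprn_gt0 ?ltr0n // -!natrX ler_nat.
rewrite lnXn // lnXn ?ltr0n // -[leLHS]mulr_natl -[leRHS]mulr_natl.
move=> h; rewrite -ler_pdivlMr // in h.
have -> : L%:R = 1 + L.-1%:R :> R by rewrite nat1r prednK.
have : 3 * ln t%:R / ln 2 = 3 * log2 t%:R :> R by rewrite /log2 mulrA.
by lra.
Qed.

Theorem theorem7p2 (R : realType) (t : nat -> nat) :
  {homo t : m n / (m <= n)%N} ->
  (forall n, (2 * t n <= n)%N) ->
  exists c : R, 0 < c /\
  exists N : nat, forall n : nat, (N <= n)%N ->
    forall P : protocol R n, computes R (COUNT (t n) n) P ->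
      c * count_bound R (t n) n <= (cost R P)%:R.
Proof.
(* [413 = 400 + 13], one constant for each summand of [count_bound]. *)
move=> _ t_half; exists (413%:R^-1); split; first by rewrite invr_gt0.
(* Since [n <= 2^(9 + 4q)], this threshold forces [q >= 1], so additive constants are absorbed into
   multiples of [q]. *)
exists (2 ^ 10)%N => n hn P hP.
have tn := t_half n.
have n16 : (n <= 2 ^ (9 + 4 * cost R P))%N.
  apply: leq_trans (count_cost_log R n (t n) P tn hP) _.
  by rewrite expnD expnM leq_mul.
have tlog := count_cost_up_log R n (t n) P tn hP.
move: (cost R P) n16 tlog => q n16 tlog.
have q1 : (1 <= q)%N.
  by have := leq_trans hn n16; rewrite leq_exp2l //; lia.
have q1R : 1 <= q%:R :> R by rewrite ler1n.
have logn : log2 n%:R <= 13 * q%:R :> R.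
  apply: le_trans (log2_le R n _ _ n16) _; first by apply: leq_trans hn.
  by rewrite natrD natrM; lra.
rewrite mulrC ler_pdivrMr ?ltr0n // /count_bound.
suff : (if (2 <= t n)%N then (t n)%:R / log2 (t n)%:R else 0) <= 400 * q%:R :> R.
  by lra.
case: ifP => [t2|_]; last by lra.
have [ge1 leL] := up_log_le_log2 R (t n) t2.
rewrite ler_pdivrMr; last by lra.
(* The factor 400 arises as [50 * 4 * 2], from [L <= 4 log t] and [q + 1 <= 2 q]. *)
apply: (le_trans (y := 50 * (up_log 2 (2 * (t n).+1))%:R * (q%:R + 1))).
  by rewrite natr1 -!natrM ler_nat.
have h1 := ler_wpM2r (ltW (ltr_pwDr ltr01 (ler0n R q))) leL.
have h2 : 0 <= (q%:R - 1) * log2 (t n)%:R :> R by rewrite mulr_ge0 ?subr_ge0 //; lra.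
by lra.
Qed.
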